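(* Every complex $3$-dimensional Lie algebra is isomorphic to one of the following Lie algebras on $\mathbb{C}^3$ with canonical basis $(e_1,e_2,e_3)$: \begin{itemize} \item $\mathrm{Bia}(I)$: $[e_1,e_2]=[e_2,e_3]=[e_3,e_1]=0$; \item $\mathrm{Bia}(II)$: $[e_1,e_2]=0,\ [e_2,e_3]=e_1,\ [e_3,e_1]=0$; \item $\mathrm{Bia}(IV)$: $[e_1,e_2]=0,\ [e_2,e_3]=e_1-e_2,\ [e_3,e_1]=e_1$; \item $\mathrm{Bia}(V)$: $[e_1,e_2]=0,\ [e_2,e_3]=-e_2,\ [e_3,e_1]=e_1$; \item $\mathrm{Bia}(VII_h)$ with $h\in\mathbb{C}$: $[e_1,e_2]=0,\ [e_2,e_3]=e_1-he_2,\ [e_3,e_1]=he_1+e_2$; \item $\mathrm{Bia}(IX)$: $[e_1,e_2]=e_3,\ [e_2,e_3]=e_1,\ [e_3,e_1]=e_2$. \end{itemize} The only isomorphisms between different members of this list are $\mathrm{Bia}(VII_h)\cong\mathrm{Bia}(VII_{-h})$, for $h\in\mathbb{C}\setminus\{0\}$.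
   Context: All brackets are complex bilinear and skew symmetric, and isomorphism means isomorphism of complex Lie algebras. *)

(* Defs.v *)
From HB Require Import structures.
From mathcomp Require Import all_boot all_order all_algebra.
From mathcomp Require Import ring.
From mathcomp Require Export reals complex.

Set Implicit Arguments.
Unset Strict Implicit.
Unset Printing Implicit Defensive.

Import GRing.Theory Num.Theory.
Local Open Scope ring_scope.

(* Finite-dimensional Lie algebras.  The scalars have characteristic 0, so    *)
(* skew symmetry is equivalent to [lie x, x] = 0.                             *)
HB.mixin Record Vector_isLieAlgebra (K : numFieldType) L of Vector K L := {
  lie_bracket : L -> L -> L;
  lie_linearl : forall y : L, linear (fun x => lie_bracket x y);
  lie_linearr : forall x : L, linear (lie_bracket x);
  lie_skew : forall x y : L, lie_bracket x y = - lie_bracket y x;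
  lie_jacobi : forall x y z : L,
    lie_bracket x (lie_bracket y z) + lie_bracket y (lie_bracket z x)
      + lie_bracket z (lie_bracket x y) = 0
}.

#[short(type="lieAlgType")]
HB.structure Definition LieAlgebra (K : numFieldType) :=
  { L of Vector_isLieAlgebra K L & Vector K L }.

Notation "[ 'lie' x , y ]" := (lie_bracket x y)
  (at level 0, x, y at level 99, format "[ 'lie'  x ,  y ]") : ring_scope.

Definition lie_isomorphic (K : numFieldType) (L M : lieAlgType K) : Prop :=
  exists f : {linear L -> M},
    bijective f /\ forall x y : L, f [lie x, y] = [lie f x, f y].

Definition e1 {K : numFieldType} : 'rV[K]_3 := delta_mx 0 0.
Definition e2 {K : numFieldType} : 'rV[K]_3 := delta_mx 0 1.
Definition e3 {K : numFieldType} : 'rV[K]_3 := delta_mx 0 2.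

Inductive bianchi (K : numFieldType) : Type :=
  | TypeI | TypeII | TypeIV | TypeV | TypeVII (h : K) | TypeIX.

Arguments TypeI {K}.
Arguments TypeII {K}.
Arguments TypeIV {K}.
Arguments TypeV {K}.
Arguments TypeVII {K} h.
Arguments TypeIX {K}.

Definition bia12 (K : numFieldType) (t : bianchi K) : 'rV[K]_3 :=
  match t with
  | TypeI => 0
  | TypeII => 0
  | TypeIV => 0
  | TypeV => 0
  | TypeVII h => 0
  | TypeIX => e3
  end.

Definition bia23 (K : numFieldType) (t : bianchi K) : 'rV[K]_3 :=
  match t with
  | TypeI => 0
  | TypeII => e1
  | TypeIV => e1 - e2
  | TypeV => - e2
  | TypeVII h => e1 - h *: e2
  | TypeIX => e1
  end.

Definition bia31 (K : numFieldType) (t : bianchi K) : 'rV[K]_3 :=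
  match t with
  | TypeI => 0
  | TypeII => 0
  | TypeIV => e1
  | TypeV => e1
  | TypeVII h => h *: e1 + e2
  | TypeIX => e2
  end.

(* The unique bilinear skew-symmetric map with e1, e2 |-> bia12 t,            *)
(* e2, e3 |-> bia23 t and e3, e1 |-> bia31 t; see lie_Bia12, lie_Bia23 and    *)
(* lie_Bia31 below.                                                           *)
Definition bia_bracket (K : numFieldType) (t : bianchi K) (x y : 'rV[K]_3) :
    'rV[K]_3 :=
    (x 0 0 * y 0 1 - x 0 1 * y 0 0) *: bia12 t
  + (x 0 1 * y 0 2 - x 0 2 * y 0 1) *: bia23 t
  + (x 0 2 * y 0 0 - x 0 0 * y 0 2) *: bia31 t.

Definition Bia (K : numFieldType) (t : bianchi K) : Type := 'rV[K]_3.

HB.instance Definition _ (K : numFieldType) (t : bianchi K) :=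
  Vector.on (Bia t).

Section BiaLie.
Variables (K : numFieldType) (t : bianchi K).

Lemma bia_linearl (y : Bia t) :
  linear (fun x : Bia t => bia_bracket t x y : Bia t).
Proof. by move=> a u v; apply/rowP => i; rewrite /bia_bracket !mxE; ring. Qed.

Lemma bia_linearr (x : Bia t) : linear (bia_bracket t x : Bia t -> Bia t).
Proof. by move=> a u v; apply/rowP => i; rewrite /bia_bracket !mxE; ring. Qed.

Lemma bia_skew (x y : Bia t) : (bia_bracket t x y : Bia t) = - bia_bracket t y x.
Proof. by apply/rowP => i; rewrite /bia_bracket !mxE; ring. Qed.

Lemma bia_jacobi (x y z : Bia t) :
  (bia_bracket t x (bia_bracket t y z) : Bia t)
    + bia_bracket t y (bia_bracket t z x)
    + bia_bracket t z (bia_bracket t x y) = 0.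
Proof.
apply/rowP => i; rewrite /bia_bracket /bia12 /bia23 /bia31 /e1 /e2 /e3.
by case: t => [||||h|]; rewrite !mxE /=; ring.
Qed.

HB.instance Definition _ := Vector_isLieAlgebra.Build K (Bia t)
  bia_linearl bia_linearr bia_skew bia_jacobi.

Lemma lie_BiaE (x y : Bia t) : [lie x, y] = bia_bracket t x y.
Proof. by []. Qed.

Lemma lie_Bia12 : [lie e1 : Bia t, e2 : Bia t] = bia12 t.
Proof.
by apply/rowP => i; rewrite lie_BiaE /bia_bracket !mxE /=; ring.
Qed.

Lemma lie_Bia23 : [lie e2 : Bia t, e3 : Bia t] = bia23 t.
Proof.
by apply/rowP => i; rewrite lie_BiaE /bia_bracket !mxE /=; ring.
Qed.

Lemma lie_Bia31 : [lie e3 : Bia t, e1 : Bia t] = bia31 t.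
Proof.
by apply/rowP => i; rewrite lie_BiaE /bia_bracket !mxE /=; ring.
Qed.

End BiaLie.

(* Main.v *)
Require Import Defs.
From mathcomp Require Import all_boot all_order all_algebra.
From mathcomp Require Import ring.

Set Implicit Arguments.
Unset Strict Implicit.
Unset Printing Implicit Defensive.

Import GRing.Theory Num.Theory VectorInternalTheory.
Local Open Scope ring_scope.

(* A skew bilinear bracket on [K^3] is the cross product followed by a 3x3
   matrix [M].  Since [(x Q) \times (y Q) = (x \times y) (adj Q)^T], a change
   of basis replaces [M] by a nonzero multiple of [Q^T M Q], and rescaling
   the basis realizes every nonzero multiple: isomorphism is congruence up to
   a scalar.  The Jacobi identity says that the axial vector of the
   antisymmetric part of [M] is killed by [M].  Over an algebraically closed
   field the symmetric part can be brought to [diag(1, .., 1, 0, .., 0)] with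
   [r] ones; Jacobi then leaves types I and V for [r = 0], II and IV for
   [r = 1], VII_h for [r = 2] and IX for [r = 3].  Conversely [r] and the
   vanishing of the antisymmetric part are invariants, and [h^2] is one
   because [adj M = (1 + h^2) adj S] for type VII_h, with [S] the symmetric
   part of [M]. *)

(** * Diagonalization of symmetric bilinear forms by congruence *)

(** Polarization: if the diagonal of [S] vanishes and [S i j] does not, the sum of the [i]-th and
    [j]-th basis vectors takes the value [2 * S i j], nonzero in characteristic 0. *)
Lemma symmetric_nonisotropic (F : numFieldType) n (S : 'M[F]_n) :
  S^T = S -> S != 0 -> exists v : 'rV_n, (v *m S *m v^T) 0 0 != 0.
Proof.
move=> symS nzS.
have SE i j : ((delta_mx 0 i : 'rV_n) *m S *m (delta_mx 0 j)^T : 'M_1) 0 0 = S i j.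
  by rewrite -rowE trmx_delta -colE !mxE.
case: (pickP (fun i => S i i != 0)) => [i Sii | S0].
  by exists (delta_mx 0 i); rewrite SE.
have [[i j] /= Sij] : exists ij : 'I_n * 'I_n, S ij.1 ij.2 != 0.
  apply/existsP; apply: contraNT nzS; rewrite negb_exists => /forallP S0'.
  by apply/eqP/matrixP => i j; rewrite [RHS]mxE; apply/eqP/negPn/(S0' (i, j)).
exists (delta_mx 0 i + delta_mx 0 j).
have addE (A B : 'M[F]_1) : (A + B) 0 0 = A 0 0 + B 0 0 by rewrite mxE.
rewrite linearD /= !(mulmxDl, mulmxDr) !addE !SE.
have -> : S j i = S i j by rewrite -[in LHS]symS mxE.
move/negbFE/eqP: (S0 i) => ->; move/negbFE/eqP: (S0 j) => ->.
by rewrite add0r addr0 -mulr2n mulrn_eq0.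
Qed.

Lemma complete_row_unitmx (F : fieldType) n (v : 'rV[F]_n.+1) :
  v != 0 -> exists2 P : 'M_n.+1, P \in unitmx & row 0 P = v.
Proof.
(* [U^T *m v] has first row [v] and zeros elsewhere; an invertible matrix with the same effect on
   [U] has the same first row. *)
move=> nzv; pose U : 'rV[F]_n.+1 := delta_mx 0 0.
have UV : U *m (U^T *m v) = v.
  by rewrite mulmxA trmx_delta mul_delta_mx -[RHS]mul1mx; congr (_ *m _);
    apply/matrixP => i j; rewrite !ord1 !mxE.
have [|P unitP UP] := @complete_unitmx F 1 n.+1 U (U^T *m v).
  rewrite UV !rank_rV nzv; congr (nat_of_bool _); apply/esym.
  by apply/eqP => /rowP/(_ 0); rewrite !mxE => /eqP; rewrite oner_eq0.
by exists P => //; rewrite rowE -UP.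
Qed.

Lemma pid_mxS (F : fieldType) n r :
  block_mx 1%:M 0 0 (pid_mx r) = pid_mx r.+1 :> 'M[F]_(1 + n).
Proof.
apply/matrixP => i j.
case: (split_ordP i) => i' ->; case: (split_ordP j) => j' ->;
  by rewrite ?(block_mxEul, block_mxEur, block_mxEdl, block_mxEdr) !mxE ?ord1.
Qed.

(** Induction on [n]: normalize a non-isotropic vector to value 1, which takes a square root,
    complete it to a basis, and split off its orthogonal complement. *)
Lemma symmetric_congruence (F : numClosedFieldType) n (S : 'M[F]_n) :
  S^T = S -> exists2 P, P \in unitmx &
    exists2 r, (r <= n)%N & P *m S *m P^T = pid_mx r.
Proof.
elim: n S => [|n IHn] S symS.
  by exists 1%:M; rewrite ?unitmx1 //; exists 0%N;
    rewrite ?[_ *m _]thinmx0 ?[pid_mx _]thinmx0.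
have [->|nzS] := eqVneq S 0.
  exists 1%:M; rewrite ?unitmx1 //; exists 0%N => //.
  by rewrite mulmx0 mul0mx pid_mx_0.
have [w Sw] := symmetric_nonisotropic symS nzS.
pose v := (sqrtC ((w *m S *m w^T) 0 0))^-1 *: w.
have Sv : v *m S *m v^T = 1%:M.
  apply/matrixP => i j; rewrite !ord1 /v linearZ /= -!scalemxAl -scalemxAr.
  by rewrite scalerA -invfM -expr2 sqrtCK [LHS]mxE mulVf // mxE.
have nzv : v != 0.
  apply/eqP => v0; move: Sv; rewrite v0 !mul0mx => /matrixP/(_ 0 0).
  by rewrite !mxE => /esym/eqP; rewrite oner_eq0.
have [P unitP rowP] := complete_row_unitmx nzv.
pose S1 : 'M_(1 + n) := P *m S *m P^T.
have symS1 : S1^T = S1 by rewrite /S1 !trmx_mul trmxK symS mulmxA.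
pose b := ursubmx S1; pose C := drsubmx S1.
have S1E : S1 = block_mx 1%:M b b^T C.
  rewrite -[LHS]submxK; congr (block_mx _ _ _ _).
    rewrite -Sv; apply/matrixP => i j; rewrite !ord1.
    rewrite -rowP tr_row -row_mul colE mulmxA -colE -row_mul [RHS]mxE [RHS]mxE.
    rewrite -/S1 [LHS]mxE [LHS]mxE.
    by have -> : lshift n (0 : 'I_1) = 0 :> 'I_(1 + n) by apply/val_inj.
  by rewrite /b trmx_ursub symS1.
have symC : C^T = C by rewrite /C trmx_drsub symS1.
(* This is the Schur complement of the corner 1 in [S1]. Below, [E] clears [b] and [b^T], and [D]
   then applies [Q] to the complement. *)
have [|Q unitQ [r ler QE]] := IHn (C - b^T *m b).
  by rewrite linearB /= trmx_mul trmxK symC.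
pose E : 'M_(1 + n) := block_mx 1%:M 0 (- b^T) 1%:M.
pose D : 'M_(1 + n) := block_mx 1%:M 0 0 Q.
have unitE : E \in unitmx by rewrite unitmxE det_lblock !det1 mul1r unitr1.
have unitD : D \in unitmx by rewrite unitmxE det_lblock det1 mul1r -unitmxE.
exists (D *m (E *m P)).
  by rewrite !unitmx_mul unitP unitE unitD.
exists r.+1 => //; rewrite -[RHS]pid_mxS -QE.
have -> : D *m (E *m P) *m S *m (D *m (E *m P))^T = D *m (E *m S1 *m E^T) *m D^T.
  by rewrite /S1 !trmx_mul !mulmxA.
rewrite S1E /E /D !tr_block_mx !mulmx_block !trmx0 !trmx1.
rewrite !(mul1mx, mulmx1, mulmx0, mul0mx, addr0, add0r, linearN, trmxK) /=.
by rewrite trmxK !addNr mulmx0 !mul0mx oppr0 add0r mulNmx [- _ + C]addrC.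
Qed.

(** * Indices modulo 3 and explicit formulas for 3x3 matrices *)

Lemma forall_I3 (P : 'I_3 -> Prop) : P 0 -> P 1 -> P 2 -> forall i, P i.
Proof.
move=> P0 P1 P2 i; have E (j : 'I_3) : j = i :> nat -> P j -> P i by move/val_inj->.
by case: i E => [[|[|[|//]]] lti] E; [apply: E P0 | apply: E P1 | apply: E P2].
Qed.

Lemma matrix3P (A : Type) (M N : 'M[A]_3) :
  M 0 0 = N 0 0 -> M 0 1 = N 0 1 -> M 0 2 = N 0 2 ->
  M 1 0 = N 1 0 -> M 1 1 = N 1 1 -> M 1 2 = N 1 2 ->
  M 2 0 = N 2 0 -> M 2 1 = N 2 1 -> M 2 2 = N 2 2 -> M = N.
Proof.
by move=> *; apply/matrixP => i j; elim/forall_I3: i; elim/forall_I3: j.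
Qed.

Lemma sum_I3 (V : nmodType) (F : 'I_3 -> V) : \sum_i F i = F 0 + F 1 + F 2.
Proof.
rewrite !big_ord_recl big_ord0 addr0 addrA.
by congr (F _ + F _ + F _); apply/val_inj.
Qed.

Lemma add_I3 :
  ((1 + 1 = 2 :> 'I_3)%R * (1 + 2 = 0 :> 'I_3)%R * (2 + 1 = 0 :> 'I_3)%R
   * (2 + 2 = 1 :> 'I_3)%R)%type.
Proof. by do !split; apply/val_inj. Qed.

Lemma lift_I3 :
  ((lift 0 0 = 1 :> 'I_3)%R * (lift 0 1 = 2 :> 'I_3)%R * (lift 1 0 = 0 :> 'I_3)%R
   * (lift 1 1 = 2 :> 'I_3)%R * (lift 2 0 = 0 :> 'I_3)%R
   * (lift 2 1 = 1 :> 'I_3)%R)%type.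
Proof. by do !split; apply/val_inj. Qed.

(** Index addition is modulo 3; taking the complementary rows and columns in cyclic order absorbs
    the signs of the cofactors. *)
Lemma adj3E (A : comPzRingType) (M : 'M[A]_3) i j :
  \adj M i j = M (j + 1) (i + 1) * M (j + 2) (i + 2)
               - M (j + 1) (i + 2) * M (j + 2) (i + 1).
Proof.
have det2 (B : 'M[A]_2) : \det B = B 0 0 * B 1 1 - B 0 1 * B 1 0.
  rewrite (expand_det_row _ 0) !big_ord_recl big_ord0 /cofactor !det_mx11 !mxE.
  rewrite /= expr0 expr1 addr0 mul1r mulN1r mulrN.
  by congr (B _ _ * B _ _ - B _ _ * B _ _); apply/val_inj.
rewrite mxE /cofactor det2 !mxE -signr_odd.
by elim/forall_I3: i; elim/forall_I3: j; set b := odd _; vm_compute in b;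
  rewrite /b !lift_I3 ?add0r ?add_I3 ?expr0 ?expr1; ring.
Qed.

Lemma det3E (A : comPzRingType) (M : 'M[A]_3) :
  \det M = M 0 0 * (M 1 1 * M 2 2 - M 1 2 * M 2 1)
         + M 0 1 * (M 1 2 * M 2 0 - M 1 0 * M 2 2)
         + M 0 2 * (M 1 0 * M 2 1 - M 1 1 * M 2 0).
Proof.
have := congr1 (fun B : 'M_3 => B 0 0) (mul_mx_adj M).
by rewrite [RHS]mxE eqxx mulr1n => <-; rewrite mxE sum_I3 !adj3E ?add0r ?add_I3.
Qed.

(** * The cross product and its behavior under linear maps *)

Section CrossProduct.
Variable K : numFieldType.
Implicit Types (x y : 'rV[K]_3) (M Q : 'M[K]_3).

Definition cross x y : 'rV[K]_3 := bia_bracket TypeIX x y.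

Lemma crossE x y i :
  cross x y 0 i = x 0 (i + 1) * y 0 (i + 2) - x 0 (i + 2) * y 0 (i + 1).
Proof.
rewrite /cross /bia_bracket !mxE.
by elim/forall_I3: i; rewrite /= ?add0r ?add_I3; ring.
Qed.

Lemma cross_mulmx x y Q : cross (x *m Q) (y *m Q) = cross x y *m (\adj Q)^T.
Proof.
apply/rowP => i; rewrite crossE !mxE !sum_I3 !crossE ![_^T _ _]mxE !adj3E.
by elim/forall_I3: i; rewrite ?add0r ?add_I3; ring.
Qed.

Lemma cross_delta i :
  cross (delta_mx 0 (i + 1)) (delta_mx 0 (i + 2)) = delta_mx 0 i.
Proof.
apply/rowP => j; rewrite crossE !mxE.
by elim/forall_I3: i; elim/forall_I3: j; rewrite ?add0r ?add_I3 /=; ring.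
Qed.

Lemma cross_mulmx_inj M N :
  (forall x y, cross x y *m M = cross x y *m N) -> M = N.
Proof. by move=> MN; apply/row_matrixP => i; rewrite !rowE -cross_delta MN. Qed.

(** The transposed adjugate is the action induced on cross products, and that action is
    functorial. *)
Lemma adj_mulmx3 M N : \adj (M *m N) = \adj N *m \adj M.
Proof.
apply: trmx_inj; apply: cross_mulmx_inj => x y.
by rewrite -cross_mulmx !mulmxA !cross_mulmx trmx_mul mulmxA.
Qed.

Lemma adjZ3 a M : \adj (a *: M) = a ^+ 2 *: \adj M.
Proof. by apply/matrixP => i j; rewrite [RHS]mxE !adj3E !mxE; ring. Qed.

Lemma cross_mulmx_tr x y Q :
  cross (x *m Q) (y *m Q) *m Q^T = \det Q *: cross x y.
Proof.
by rewrite cross_mulmx -mulmxA -trmx_mul mul_mx_adj tr_scalar_mx mul_mx_scalar.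
Qed.

Lemma crossZ a b x y : cross (a *: x) (b *: y) = (a * b) *: cross x y.
Proof. by apply/rowP => i; rewrite [RHS]mxE !crossE !mxE; ring. Qed.

(* Row [i] is the bracket of the two other basis vectors, in cyclic order, so *)
(* that [bia_bracket t] is the cross product followed by this matrix.         *)
Definition structure_mx (t : bianchi K) : 'M[K]_3 :=
  \matrix_i (if i == 0 then bia23 t else if i == 1 then bia31 t else bia12 t).

Lemma bia_bracketE t x y : bia_bracket t x y = cross x y *m structure_mx t.
Proof.
apply/rowP => j; rewrite [RHS]mxE sum_I3 !crossE ?add0r ?add_I3.
rewrite ![structure_mx _ _ _]mxE /=.
by rewrite /bia_bracket !mxE; ring.
Qed.

End CrossProduct.

(** The vector whose dot product with [cross x y] is [x *m (M - M^T) *m y^T]. *)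
Definition axial (K : pzRingType) (M : 'M[K]_3) : 'rV[K]_3 :=
  \row_i (M (i + 1) (i + 2) - M (i + 2) (i + 1)).

Definition has_structure (K : numFieldType) (L : lieAlgType K) (M : 'M[K]_3) :=
  exists f : {linear L -> 'rV[K]_3},
    bijective f /\ forall x y, f [lie x, y] = cross (f x) (f y) *m M.

(** * Lie algebras of dimension 3 as matrices up to scaled congruence *)

Section LieStructure.
Variable K : numFieldType.

Lemma has_structure_Bia (L : lieAlgType K) t :
  has_structure L (structure_mx t) <-> lie_isomorphic L (Bia t).
Proof.
by split=> -[f [bijf fM]]; exists f; split=> // x y;
  rewrite fM // lie_BiaE bia_bracketE.
Qed.

Lemma has_structure_congruence (L : lieAlgType K) M Q (k : K) :
  has_structure L M -> Q \in unitmx -> k != 0 ->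
  has_structure L (k *: (Q^T *m M *m Q)).
Proof.
move=> [f [bijf fM]] unitQ nzk.
have nzQ : \det Q != 0 by rewrite -unitfE -unitmxE.
(* Scaling the basis change by [mu] multiplies the image of a bracket by [mu] and the cross product
   of images by [mu ^+ 2], so the factors match when [mu * k * \det Q = 1]. *)
pose mu := (k * \det Q)^-1.
have nzmu : mu != 0 by rewrite invr_eq0 mulf_neq0.
exists (mulmxr (mu *: Q) \o f); split => [|x y /=].
  apply: bij_comp => //; exists (mulmxr (mu^-1 *: invmx Q)) => x /=;
    rewrite -!scalemxAr -scalemxAl scalerA ?mulVf ?mulfV // scale1r.
    by rewrite mulmxK.
  by rewrite mulmxKV.
rewrite fM -!scalemxAr !mulmxA crossZ -scalemxAl cross_mulmx_tr scalerA.
by rewrite -!scalemxAl scalerA /mu; congr (_ *: _); field; rewrite nzk nzQ.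
Qed.

Lemma Bia_congruence (s t : bianchi K) :
  lie_isomorphic (Bia s) (Bia t) ->
  exists2 Q, Q \in unitmx &
    exists2 k, k != 0 & k *: structure_mx t = Q^T *m structure_mx s *m Q.
Proof.
move=> [f [bijf fM]].
pose Q := lin1_mx (f : 'rV_3 -> 'rV_3).
have fE (x : 'rV_3) : f x = x *m Q by rewrite mul_rV_lin1.
have unitQ : Q \in unitmx.
  rewrite -row_free_unit; apply: inj_row_free => v; rewrite -fE => fv0.
  by apply: (bij_inj bijf); rewrite fv0 linear0.
exists Q => //; exists (\det Q); first by rewrite -unitfE -unitmxE.
(* Multiplying this identity by [Q^T] on the left turns the adjugate into the scalar [\det Q]. *)
have QsE : (\adj Q)^T *m structure_mx t = structure_mx s *m Q.
  apply: cross_mulmx_inj => x y; rewrite !mulmxA -cross_mulmx -!bia_bracketE.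
  by rewrite -!fE -!lie_BiaE fM.
by rewrite -mulmxA -QsE mulmxA -trmx_mul mul_adj_mx tr_scalar_mx mul_scalar_mx.
Qed.

(** The Jacobi identity on the standard basis says that the sum of the [cross e_i (e_i *m M)] is
    killed by [M], and this sum is [axial M]. *)
Lemma axial_structure (L : lieAlgType K) M :
  has_structure L M -> axial M *m M = 0.
Proof.
move=> [f [[g fK gK] fM]].
have := congr1 f (lie_jacobi (g e1) (g e2) (g e3)).
rewrite !linearD /= linear0 !fM !gK -!mulmxDl => J; rewrite -[RHS]J.
have := @cross_delta K 0; rewrite ?add0r ?add_I3 -/e2 -/e3 => ->.
have := @cross_delta K 1; rewrite ?add0r ?add_I3 -/e2 -/e3 => ->.
have := @cross_delta K 2; rewrite ?add0r ?add_I3 -/e2 -/e3 => ->.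

congr (_ *m _); apply/rowP => i.
have addE (u v : 'rV[K]_3) j : (u + v) 0 j = u 0 j + v 0 j by rewrite mxE.
rewrite -!rowE 2!addE !crossE !mxE.
by elim/forall_I3: i; rewrite ?add0r ?add_I3 /=; ring.
Qed.

Lemma has_structure_dim3 (L : lieAlgType K) :
  \dim {:L} = 3%N -> exists M, has_structure L M.
Proof.
rewrite dimvf => dimL.
have [f bijf] : exists f : {linear L -> 'rV[K]_3}, bijective f.
  by case: _ / dimL; exists v2r; exists r2v; [exact: v2rK | exact: r2vK].
have lieDl (x y z : L) : [lie x + y, z] = [lie x, z] + [lie y, z].
  by have := lie_linearl z 1 x y; rewrite !scale1r.
have lieDr (x y z : L) : [lie z, x + y] = [lie z, x] + [lie z, y].
  by have := lie_linearr z 1 x y; rewrite !scale1r.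
have lie0l (x : L) : [lie 0, x] = 0
  by apply: (addrI [lie 0, x]); rewrite -lieDl !addr0.
have lie0r (x : L) : [lie x, 0] = 0
  by apply: (addrI [lie x, 0]); rewrite -lieDr !addr0.
have lieZl a (x z : L) : [lie a *: x, z] = a *: [lie x, z].
  by have := lie_linearl z a x 0; rewrite !addr0 lie0l addr0.
have lieZr a (x z : L) : [lie z, a *: x] = a *: [lie z, x].
  by have := lie_linearr z a x 0; rewrite !addr0 lie0r addr0.
have liexx (x : L) : [lie x, x] = 0.
  apply: (@scalerI K _ 2%:R); first by rewrite pnatr_eq0.
  by rewrite scaler0 scaler_nat mulr2n {1}lie_skew addNr.
have [g fK gK] := bijf; pose b i := g (delta_mx 0 i).
have fb i : f (b i) = delta_mx 0 i by rewrite gK.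
have xE x : x = f x 0 0 *: b 0 + f x 0 1 *: b 1 + f x 0 2 *: b 2.
  apply: (bij_inj bijf); rewrite !linearD !linearZ /= !fb.
  by rewrite [LHS]row_sum_delta sum_I3.
exists (\matrix_i f [lie b (i + 1), b (i + 2)]), f; split => // x y.
rewrite {1}[x]xE {1}[y]xE !(lieDl, lieDr, lieZl, lieZr) !liexx.
rewrite [ [lie b 1, b 0] ]lie_skew [ [lie b 2, b 1] ]lie_skew.
rewrite [ [lie b 0, b 2] ]lie_skew.
apply/rowP => j.
rewrite !linearD !linearZ /= !linearN linear0 [RHS]mxE sum_I3 !crossE !mxE.
by rewrite ?add0r ?add_I3; ring.
Qed.

End LieStructure.

(** * Reduction of the structure matrix to the list *)

Section Classification.
Variable K : numClosedFieldType.

(** Treats types V ([M 0 0 = 0]) and IV ([M 0 0 = 1]) together: the symmetric part is concentrated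
    at the first diagonal entry and the antisymmetric part is nonzero. *)
Lemma has_structure_TypeV_add (L : lieAlgType K) (M : 'M[K]_3) :
  has_structure L M ->
  M 1 0 = - M 0 1 -> M 0 2 = - M 2 0 -> M 2 1 = - M 1 2 ->
  M 1 1 = 0 -> M 2 2 = 0 -> M 1 2 * M 0 0 = 0 ->
  (M 0 1 != 0) || (M 2 0 != 0) || (M 1 2 != 0) ->
  has_structure L (M 0 0 *: delta_mx 0 0 + structure_mx TypeV).
Proof.
move=> LM M10 M02 M21 M11 M22 /eqP; rewrite mulf_eq0 => aM abc.
(* Half the axial vector of [M] spans the kernel of its antisymmetric part.   *)
pose w : 'rV[K]_3 := M 1 2 *: e1 + M 2 0 *: e2 + M 0 1 *: e3.
pose P u v : 'M[K]_3 := \matrix_i (if i == 0 then u else if i == 1 then v else w).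
(* The antisymmetric part pairs [u] with [v] to [\det (P u v)], so determinant -1 produces the entry
   -1 of type V. Taking [u = e1] and [v] without first coordinate preserves [M 0 0]; if only [M 1 2]
   is nonzero, then [M 0 0 = 0] and [u] is free. *)
suff [u [v [detP <-]]] : exists u v, \det (P u v) = -1 /\
    P u v *m M *m (P u v)^T = M 0 0 *: delta_mx 0 0 + structure_mx TypeV.
  have := @has_structure_congruence _ _ M (P u v)^T 1 LM.
  by rewrite unitmx_tr unitmxE detP unitrN1 oner_eq0 scale1r trmxK; apply.
have ME := (M10, M02, M21, M11, M22).
have [c0|nzc] := eqVneq (M 0 1) 0; last first.
  exists e1, (- (M 0 1)^-1 *: e2); rewrite /P /w.
  split; first by rewrite det3E !mxE /= ?mxE /=; field.
  by apply: matrix3P; rewrite !mxE !sum_I3 ?mxE ?sum_I3 ?mxE /= ?mxE /= !ME;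
    case/orP: aM => /eqP ->; field.
have [b0|nzb] := eqVneq (M 2 0) 0; last first.
  exists e1, ((M 2 0)^-1 *: e3); rewrite /P /w.
  split; first by rewrite det3E !mxE /= ?mxE /=; field.
  by apply: matrix3P; rewrite !mxE !sum_I3 ?mxE ?sum_I3 ?mxE /= ?mxE /= !ME c0;
    case/orP: aM => /eqP ->; field.
have nza : M 1 2 != 0 by move: abc; rewrite c0 b0 eqxx.
move: aM; rewrite (negPf nza) /= => /eqP s0.
exists e2, (- (M 1 2)^-1 *: e3); rewrite /P /w.
split; first by rewrite det3E !mxE /= ?mxE /=; field.
by apply: matrix3P; rewrite !mxE !sum_I3 ?mxE ?sum_I3 ?mxE /= ?mxE /= !ME s0 c0 b0;
  field.
Qed.

Lemma has_structure_bianchi (L : lieAlgType K) (M : 'M[K]_3) :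
  has_structure L M -> exists t, lie_isomorphic L (Bia t).
Proof.
move=> LM0; have [|P unitP [r ler PE]] := @symmetric_congruence K _ (M + M^T).
  by rewrite linearD /= trmxK addrC.
(* The factor 2 makes the symmetric part of [N], half of [N + N^T], equal to [pid_mx r]. *)
pose N := 2%:R *: (P *m M *m P^T).
have LN : has_structure L N.
  by rewrite /N -{1}[P]trmxK; apply: has_structure_congruence;
    rewrite ?unitmx_tr ?pnatr_eq0.
have symN i j : N i j + N j i = 2%:R * ((i == j :> nat) && (i < r)%N)%:R.
  have -> : N i j + N j i = (N + N^T) i j by rewrite !mxE.
  rewrite /N linearZ /= -scalerDr !trmx_mul trmxK mulmxA -mulmxDl -mulmxDr PE.
  by rewrite !mxE.
clearbody N.
have diagN i : N i i = (i < r)%:R.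
  apply: (@mulfI K 2%:R); first by rewrite pnatr_eq0.
  by have := symN i i; rewrite eqxx /= => <-; ring.
have oppN (i j : 'I_3) : i != j :> nat -> N i j = - N j i.
  by move=> /negPf ij; apply/eqP; rewrite -addr_eq0 symN ij mulr0.
have N10 := oppN 1 0 isT; have N02 := oppN 0 2 isT; have N21 := oppN 2 1 isT.
have kerN j : N 1 2 * N 0 j + N 2 0 * N 1 j + N 0 1 * N 2 j = 0.
  apply: (@mulfI K 2%:R); first by rewrite pnatr_eq0.
  have := congr1 (fun v : 'rV_3 => v 0 j) (axial_structure LN).
  rewrite !mxE sum_I3 !mxE ?add0r ?add_I3 N10 N02 N21 mulr0 => <-; ring.
(* The antisymmetric part kills its own axial vector, so only the diagonal term of [kerN] survives:
   each diagonal 1 forces one antisymmetric entry to vanish. *)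
have s0 : N 1 2 * N 0 0 = 0 by rewrite -(kerN 0) N10; ring.
have s1 : N 2 0 * N 1 1 = 0 by rewrite -(kerN 1) N21; ring.
have s2 : N 0 1 * N 2 2 = 0 by rewrite -(kerN 2) N02; ring.
have isoN t : N = structure_mx t -> exists t, lie_isomorphic L (Bia t).
  by move=> Nt; exists t; apply/has_structure_Bia; rewrite -Nt.
move: s0 s1 s2 LN isoN; rewrite !diagN.
case: r ler diagN {PE symN} => [|[|[|[|//]]]] _ diagN /=; rewrite ?mulr1 ?mulr0;
  move: (diagN 0) (diagN 1) (diagN 2) => /= N00 N11 N22 s0 s1 s2 LN isoN.
- have NE := (N10, N02, N21, N00, N11, N22).
  have [abc|] := boolP ((N 0 1 != 0) || (N 2 0 != 0) || (N 1 2 != 0)).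
    exists TypeV; apply/has_structure_Bia.
    have := has_structure_TypeV_add LN N10 N02 N21 N11 N22 _ abc.
    by rewrite N00 mulr0 scale0r add0r; apply.
  rewrite !negb_or !negbK => /andP[/andP[/eqP c0 /eqP b0] /eqP a0].
  apply: (isoN TypeI).
  by apply: matrix3P; rewrite !mxE /= ?mxE /= ?NE ?a0 ?b0 ?c0; ring.
- have NE := (N10, N02, N21, N00, N11, N22).
  have [abc|] := boolP ((N 0 1 != 0) || (N 2 0 != 0) || (N 1 2 != 0)).
    exists TypeIV; apply/has_structure_Bia.
    have := has_structure_TypeV_add LN N10 N02 N21 N11 N22 _ abc.
    rewrite N00 mulr1 scale1r => /(_ s0); congr has_structure.
    by apply: matrix3P; rewrite !mxE /= ?mxE /=; ring.
  rewrite !negb_or !negbK => /andP[/andP[/eqP c0 /eqP b0] /eqP a0].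
  apply: (isoN TypeII).
  by apply: matrix3P; rewrite !mxE /= ?mxE /= ?NE ?a0 ?b0 ?c0; ring.
(* In rank 2 only [N 0 1] remains free; it is [- h] because the first row of type VII is
   [e1 - h *: e2]. *)
- apply: (isoN (TypeVII (- N 0 1))).
  by apply: matrix3P;
    rewrite !mxE /= ?mxE /= ?(N10, N02, N21, N00, N11, N22, s0, s1); ring.
apply: (isoN TypeIX).
by apply: matrix3P;
  rewrite !mxE /= ?mxE /= ?(N10, N02, N21, N00, N11, N22, s0, s1, s2); ring.
Qed.

End Classification.

(** * Invariants that separate the members of the list *)

Section Invariants.
Variable K : numFieldType.

Definition sym_rank (t : bianchi K) : nat :=
  match t with
  | TypeI => 0 | TypeII => 1 | TypeIV => 1 | TypeV => 0 | TypeVII _ => 2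
  | TypeIX => 3
  end.

Lemma structure_mx_sym t :
  structure_mx t + (structure_mx t)^T = 2%:R *: pid_mx (sym_rank t).
Proof.
by case: t => [||||h|]; apply: matrix3P; rewrite !mxE /= ?mxE /=; ring.
Qed.

Lemma adj_structure_VII (h : K) :
  \adj (structure_mx (TypeVII h)) =
    (1 + h ^+ 2) *: \adj (pid_mx 2).
Proof.
by apply: matrix3P; rewrite [RHS]mxE !adj3E ?add0r ?add_I3 !mxE /= ?mxE /=; ring.
Qed.

Lemma sym_congruence (s t : bianchi K) Q k :
  k *: structure_mx t = Q^T *m structure_mx s *m Q ->
  k *: (pid_mx (sym_rank t) : 'M_3) = Q^T *m pid_mx (sym_rank s) *m Q.
Proof.
move=> st; apply: (@scalerI K _ 2%:R); first by rewrite pnatr_eq0.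
rewrite scalerA mulrC -scalerA scalemxAl scalemxAr -!structure_mx_sym.
have ktr : k *: (structure_mx t)^T = (k *: structure_mx t)^T by rewrite linearZ.
by rewrite mulmxDr mulmxDl scalerDr ktr st !trmx_mul trmxK mulmxA.
Qed.

Lemma sym_rank_congruence (s t : bianchi K) Q k :
  Q \in unitmx -> k != 0 ->
  k *: structure_mx t = Q^T *m structure_mx s *m Q -> sym_rank s = sym_rank t.
Proof.
move=> unitQ nzk /sym_congruence/(congr1 mxrank).
have freeQ : row_free Q by rewrite row_free_unit.
have rankE u : \rank (pid_mx (sym_rank u) : 'M[K]_3) = sym_rank u.
  by rewrite rank_pid_mx //; case: u.
rewrite (eqmx_scale _ nzk) mxrankMfree // -[RHS]mxrank_tr trmx_mul trmxK.
by rewrite mxrankMfree // mxrank_tr !rankE => ->.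
Qed.

(** Separates I from V and II from IV, where the rank of the symmetric part agrees. *)
Lemma symmetric_structure_congruence (s t : bianchi K) Q k :
  Q \in unitmx -> k != 0 ->
  k *: structure_mx t = Q^T *m structure_mx s *m Q ->
  ((structure_mx s)^T == structure_mx s) = ((structure_mx t)^T == structure_mx t).
Proof.
move=> unitQ nzk st; have unitQT : Q^T \in unitmx by rewrite unitmx_tr.
have ktr : k *: (structure_mx t)^T = (k *: structure_mx t)^T by rewrite linearZ.
rewrite -[RHS](inj_eq (scalerI nzk)) ktr st !trmx_mul trmxK mulmxA.
by rewrite (can_eq (mulmxK unitQ)) (can_eq (mulKmx unitQT)).
Qed.

Lemma typeVII_congruence (h h' : K) Q k :
  k != 0 ->
  k *: structure_mx (TypeVII h') = Q^T *m structure_mx (TypeVII h) *m Q ->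
  h ^+ 2 = h' ^+ 2.
Proof.
move=> nzk st.
(* Both adjugates contain the same congruence transform of [\adj (pid_mx 2)]. Eliminating it leaves
   [1 + h ^+ 2] against [1 + h' ^+ 2] with common factor [k ^+ 2], read off at the only nonzero
   entry. *)
have := congr1 adjugate (sym_congruence st); have := congr1 adjugate st.
rewrite !adj_mulmx3 !adjZ3 !adj_structure_VII /= -scalemxAl -scalemxAr => E1 E2.
move: E1; rewrite -E2 !scalerA => /matrixP/(_ 2 2);
rewrite [LHS]mxE [RHS]mxE !adj3E.
rewrite ?add_I3 !mxE /= mul1r mul0r subr0 !mulr1.
by rewrite [RHS]mulrC => /(mulfI (expf_neq0 2 nzk))/addrI/esym.
Qed.

Lemma typeVII_oppr (h : K) :
  lie_isomorphic (Bia (TypeVII h)) (Bia (TypeVII (- h))).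
Proof.
apply/has_structure_Bia.
have Lh : has_structure (Bia (TypeVII h)) (structure_mx (TypeVII h)).
  by exists idfun; split; [exists id | move=> x y; rewrite -bia_bracketE].
(* Reversing one of the first two basis vectors negates the entries [h] and [- h] and fixes the
   diagonal. *)
pose d : 'rV[K]_3 := \row_i (if i == 1 then -1 else 1).
have detd : \det (diag_mx d) = -1 by rewrite det3E !mxE /=; ring.
have unitd : diag_mx d \in unitmx by rewrite unitmxE detd unitrN1.
have := has_structure_congruence Lh unitd (oner_neq0 K).
congr has_structure; rewrite scale1r tr_diag_mx mul_diag_mx mul_mx_diag.
by apply: matrix3P; rewrite !mxE /= ?mxE /=; ring.
Qed.

Lemma neq_Bia_isomorphic (s t : bianchi K) :
  s <> t -> lie_isomorphic (Bia s) (Bia t) ->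
  exists h, h <> 0 /\ s = TypeVII h /\ t = TypeVII (- h).
Proof.
move=> neq_st /Bia_congruence[Q unitQ [k nzk st]].
have := sym_rank_congruence unitQ nzk st.
have := symmetric_structure_congruence unitQ nzk st.
have not_sym (M : 'M[K]_3) : M 0 1 - M 1 0 = -2 -> M^T == M = false.
  move=> M01; apply/eqP => symM; move: M01; rewrite -{1}symM mxE subrr.
  by move/esym/eqP; rewrite oppr_eq0 pnatr_eq0.
have symI : (structure_mx TypeI)^T == structure_mx TypeI :> 'M[K]_3.
  by apply/eqP/matrixP => i j; elim/forall_I3: i; elim/forall_I3: j; rewrite !mxE.
have symII : (structure_mx TypeII)^T == structure_mx TypeII :> 'M[K]_3.
  by apply/eqP/matrixP => i j; elim/forall_I3: i; elim/forall_I3: j; rewrite !mxE.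
have symIV : (structure_mx TypeIV)^T == structure_mx TypeIV :> 'M[K]_3 = false.
  by apply: not_sym; rewrite !mxE /= ?mxE /=; ring.
have symV : (structure_mx TypeV)^T == structure_mx TypeV :> 'M[K]_3 = false.
  by apply: not_sym; rewrite !mxE /= ?mxE /=; ring.
(* Rank and symmetry exclude every pair of distinct constructors, so only two algebras of type VII
   remain. *)
case: s t neq_st st => [||||h|] [||||h'|] //= neq_st st;
  rewrite ?symI ?symII ?symIV ?symV // => _ _.
have /eqP := typeVII_congruence nzk st; rewrite eqf_sqr => /orP[]/eqP hh'.
  by case: neq_st; rewrite hh'.
exists h; split; last by rewrite hh' opprK.
move=> h0; apply: neq_st; have h'0 : h' = 0 by rewrite -[h']opprK -hh' h0 oppr0.
by rewrite h0 h'0.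
Qed.

End Invariants.

Theorem mainTheorem2 (R : realType) :
  (forall L : lieAlgType R[i], \dim (fullv : {vspace L}) = 3%N ->
     exists t : bianchi R[i], lie_isomorphic L (Bia t)) /\
  (forall s t : bianchi R[i], s <> t ->
     (lie_isomorphic (Bia s) (Bia t) <->
      exists h : R[i], h <> 0 /\ s = TypeVII h /\ t = TypeVII (- h))).
Proof.
split=> [L /has_structure_dim3[M LM] | s t neq_st].
  exact: has_structure_bianchi LM.
split; first exact: neq_Bia_isomorphic.
by move=> [h [_ [-> ->]]]; exact: typeVII_oppr.
Qed.
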